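(* Let $n\ge1$, let $C(\partial)\in\mathbb{C}[\partial]^{n\times n}$, and let $\mathfrak{L}=\frac{d}{d\partial}+C(\partial)$, regarded as the linear operator $X(\partial)\mapsto X'(\partial)+C(\partial)X(\partial)$ on $\mathbb{C}[\partial]^{n\times n}$. For any $a,b\in\mathbb{C}$, the matrix $$A(\partial,\lambda)=(\partial+a\lambda+b)\sum_{k=0}^\infty(\mathfrak{L}^kI_n)\frac{\lambda^k}{k!}\in(\mathbb{C}[\partial][[\lambda]])^{n\times n}$$ is a solution of $$(\lambda-\mu)A(\partial,\lambda+\mu)=A(\partial,\lambda)A(\partial+\lambda,\mu)-A(\partial,\mu)A(\partial+\mu,\lambda).$$
   Context: $I_n$ is the $n\times n$ identity matrix, and $X'(\partial)$ denotes the entrywise derivative with respect to the variable $\partial$. (The displayed equation is exactly the condition for $L_\lambda(v_1,\ldots,v_n)=(v_1,\ldots,v_n)A(\partial,\lambda)$ to define a generalized conformal module structure over the Virasoro conformal algebra on the free $\mathbb{C}[\partial]$-module with basis $v_1,\ldots,v_n$.) *)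

(* Defs.v *)
From HB Require Import structures.
From mathcomp Require Import all_boot all_order all_algebra.
From mathcomp Require Export complex.
From mathcomp Require Import boolp.
From mathcomp Require Export reals.

Set Implicit Arguments.
Unset Strict Implicit.
Unset Printing Implicit Defensive.
Import GRing.Theory.
Local Open Scope ring_scope.

(* Formal power series R[[t]]: F k is the coefficient of t^k. *)
Record fps (R : Type) : Type := Fps { fps_coef :> nat -> R }.

HB.instance Definition _ (R : Type) := gen_eqMixin (fps R).
HB.instance Definition _ (R : Type) := gen_choiceMixin (fps R).

Lemma fpsP (R : Type) (F G : fps R) : F =1 G <-> F = G.
Proof.
split=> [|-> //]; case: F G => [f] [g] /= eq_fg.
by congr Fps; apply/funext.
Qed.

Section FpsRing.
Variable R : comNzRingType.
Implicit Types F G H : fps R.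

Definition fps_zero : fps R := Fps (fun=> 0).
Definition fps_opp F : fps R := Fps (fun k => - F k).
Definition fps_add F G : fps R := Fps (fun k => F k + G k).
Definition fps_one : fps R := Fps (fun k => (k == 0%N)%:R).
Definition fps_mul F G : fps R :=
  Fps (fun k => \sum_(i < k.+1) F i * G (k - i)%N).

Fact fps_addA : associative fps_add.
Proof. by move=> F G H; apply/fpsP => k /=; rewrite addrA. Qed.
Fact fps_addC : commutative fps_add.
Proof. by move=> F G; apply/fpsP => k /=; rewrite addrC. Qed.
Fact fps_add0 : left_id fps_zero fps_add.
Proof. by move=> F; apply/fpsP => k /=; rewrite add0r. Qed.
Fact fps_addN : left_inverse fps_zero fps_opp fps_add.
Proof. by move=> F; apply/fpsP => k /=; rewrite addNr. Qed.

HB.instance Definition _ :=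
  GRing.isZmodule.Build (fps R) fps_addA fps_addC fps_add0 fps_addN.

Fact fps_mulC : commutative fps_mul.
Proof.
move=> F G; apply/fpsP => k /=; rewrite (reindex_inj rev_ord_inj) /=.
by apply: eq_bigr => i _; rewrite (sub_ordK i) mulrC.
Qed.

Fact fps_mulA : associative fps_mul.
Proof.
move=> F G H; rewrite [fps_mul G H]fps_mulC [RHS]fps_mulC.
apply/fpsP => i /=.
pose coef3 j k := F j * (G (i - j - k)%N * H k).
transitivity (\sum_(j < i.+1) \sum_(k < i.+1 | (k <= i - j)%N) coef3 j k).
  apply: eq_bigr => /= j _; rewrite big_distrr /=.
  rewrite (big_ord_narrow_leq (leq_subr _ _)).
  by apply: eq_bigr => k _; rewrite /coef3 [H _ * _]mulrC.
rewrite (exchange_big_dep predT) //=; apply: eq_bigr => k _.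
transitivity (\sum_(j < i.+1 | (j <= i - k)%N) coef3 j k).
  apply: eq_bigl => j; rewrite -ltnS -(ltnS j) -!subSn ?leq_ord //.
  by rewrite -subn_gt0 -(subn_gt0 j) -!subnDA addnC.
rewrite (big_ord_narrow_leq (leq_subr _ _)) big_distrr /=.
apply: eq_bigr => j _; rewrite /coef3 -!subnDA addnC mulrA.
by rewrite mulrC.
Qed.

Fact fps_mul1 : left_id fps_one fps_mul.
Proof.
move=> F; apply/fpsP => k /=; rewrite big_ord_recl subn0 mul1r.
by rewrite big1 ?addr0 // => i _; rewrite mul0r.
Qed.

Fact fps_mulDl : left_distributive fps_mul fps_add.
Proof.
move=> F G H; apply/fpsP => k /=; rewrite -big_split.
by apply: eq_bigr => i _; rewrite mulrDl.
Qed.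

Fact fps_one_neq0 : fps_one != 0.
Proof.
by apply/eqP => /fpsP/(_ 0%N)/= /eqP; rewrite oner_eq0.
Qed.

HB.instance Definition _ :=
  GRing.Zmodule_isComNzRing.Build (fps R)
    fps_mulA fps_mulC fps_mul1 fps_mulDl fps_one_neq0.

Definition fpsC (c : R) : fps R := Fps (fun k => c *+ (k == 0%N)).
Definition fpsX : fps R := Fps (fun k => (k == 1%N)%:R).

End FpsRing.

Arguments fpsX {R}.

(* For a coefficient ring R, the ring R[[lambda, mu]] is represented as
   fps (fps R) = R[[lambda]][[mu]]: the coefficient of lambda^i mu^j in F is
   F j i. *)

Definition lam {R : comNzRingType} : fps (fps R) := fpsC fpsX.
Definition mu {R : comNzRingType} : fps (fps R) := fpsX.

Definition fps_swap {R : Type} (F : fps (fps R)) : fps (fps R) :=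
  Fps (fun j => Fps (fun i => F i j)).

Definition at_lam {R : comNzRingType} (F : fps R) : fps (fps R) := fpsC F.
Definition at_mu {R : comNzRingType} (F : fps R) : fps (fps R) :=
  fps_swap (at_lam F).

(* F(lambda + mu): by the binomial formula, the coefficient of lambda^i mu^j in
   sum_k F_k (lambda + mu)^k is 'C(i + j, i) F_(i + j). *)
Definition at_lam_add_mu {R : comNzRingType} (F : fps R) : fps (fps R) :=
  Fps (fun j => Fps (fun i => F (i + j)%N *+ 'C(i + j, i))).

(* In the series over {poly K}, the polynomial variable 'X is the derivation
   variable d. *)

(* p(d + t) as an element of K[d][[t]]. *)
Definition poly_shift {K : comNzRingType} (p : {poly K}) : fps {poly K} :=
  (map_poly (fun c : K => fpsC c%:P) p).[fpsC 'X + fpsX].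

(* F(d + lambda, mu) and F(d + mu, lambda), for F = F(d, t). *)
Definition at_shift_lam_mu {K : comNzRingType} (F : fps {poly K}) :
  fps (fps {poly K}) := Fps (fun j => poly_shift (F j)).
Definition at_shift_mu_lam {K : comNzRingType} (F : fps {poly K}) :
  fps (fps {poly K}) := fps_swap (at_shift_lam_mu F).

Section Solution.
Variables (K : fieldType) (n : nat).

(* The operator d/dd + C(d). *)
Definition frakL (C X : 'M[{poly K}]_n) : 'M[{poly K}]_n :=
  map_mx (fun p => p^`()) X + C *m X.

(* sum_k (L^k I_n) t^k / k!, as a matrix of power series. *)
Definition expL (C : 'M[{poly K}]_n) : 'M[fps {poly K}]_n :=
  \matrix_(i, j)
    Fps (fun k => (k`!%:R : K)^-1 *: (iter k (frakL C) 1%:M) i j).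

Definition solA (C : 'M[{poly K}]_n) (a b : K) : 'M[fps {poly K}]_n :=
  (fpsC 'X + fpsC a%:P * fpsX + fpsC b%:P) *: expL C.

End Solution.

(* Main.v *)
(** The Leibniz rule [L(XY) = L(X) Y + X Y'] iterates to
    [L^i Y = sum_p 'C(i, p) (L^p I) Y^(i-p)]. Taken at [Y = L^j I], this says
    that [E = sum_k (L^k I) t^k / k!] satisfies the cocycle identity
    [E(d, lambda) E(d + lambda, mu) = E(d, lambda + mu)], whose right-hand side
    is symmetric in [lambda] and [mu]. Hence both products on the right of the
    equation are scalar multiples of [E(d, lambda + mu)], and what is left is
    the scalar identity
    [(d + a lambda + b)(d + lambda + a mu + b)
     - (d + a mu + b)(d + mu + a lambda + b)
     = (lambda - mu)(d + a (lambda + mu) + b)]. *)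
Require Import Defs.
From HB Require Import structures.
From mathcomp Require Import all_boot all_order all_algebra.
From mathcomp Require Import ring.
Import GRing.Theory.
Local Open Scope ring_scope.

(** * Coefficients of products, and constants as a ring morphism *)

Section FpsMorphisms.
Variable R : comNzRingType.
Implicit Types (F G : fps R) (c : R).

Lemma fps_coef_sum (I : Type) (r : seq I) (P : pred I) (F : I -> fps R) k :
  (\sum_(i <- r | P i) F i) k = \sum_(i <- r | P i) F i k.
Proof. exact: (big_morph (fun G : fps R => G k)). Qed.

Lemma fps_coefM F G k : (F * G) k = \sum_(i < k.+1) F i * G (k - i)%N.
Proof. by []. Qed.

Lemma fps_coefCM c F k : (fpsC c * F) k = c * F k.
Proof.
rewrite fps_coefM big_ord_recl subn0 big1 ?addr0 //= => i _.
by rewrite mul0r.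
Qed.

Lemma fps_coefX0M F : (fpsX * F) 0%N = 0.
Proof. by rewrite fps_coefM big_ord1 mul0r. Qed.

Lemma fps_coefXSM F k : (fpsX * F) k.+1 = F k.
Proof.
rewrite fps_coefM big_ord_recl mul0r add0r big_ord_recl /= mul1r subSS subn0.
by rewrite big1 ?addr0 // => i _; rewrite mul0r.
Qed.

Lemma fps_coefXn (m k : nat) : ((fpsX : fps R) ^+ m) k = (k == m)%:R.
Proof.
elim: m k => [|m IHm] k //; rewrite exprS.
by case: k => [|k]; rewrite ?fps_coefX0M // fps_coefXSM IHm.
Qed.

Fact fpsC_is_zmod_morphism : zmod_morphism (@fpsC R).
Proof. by move=> c d; apply/fpsP => k /=; rewrite mulrnBl. Qed.

Fact fpsC_is_monoid_morphism : monoid_morphism (@fpsC R).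
Proof.
split=> [|c d]; apply/fpsP => k //.
by rewrite fps_coefCM /= mulrnAr.
Qed.

HB.instance Definition _ :=
  GRing.isZmodMorphism.Build R (fps R) (@fpsC R) fpsC_is_zmod_morphism.
HB.instance Definition _ :=
  GRing.isMonoidMorphism.Build R (fps R) (@fpsC R) fpsC_is_monoid_morphism.

End FpsMorphisms.

(** * Exchange of the two variables, and substitution of their sum *)

Section BivariateFps.
Variable R : comNzRingType.
Implicit Types (F G : fps R) (c : R).

Fact fps_swap_is_zmod_morphism : zmod_morphism (@fps_swap R).
Proof. by move=> F G; apply/fpsP => j; apply/fpsP => i. Qed.

Fact fps_swap_is_monoid_morphism : monoid_morphism (@fps_swap R).
Proof.
split=> [|F G]; apply/fpsP => j; apply/fpsP => i.
  by rewrite /=; case: i j => [|i] [|j].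
rewrite -[LHS]/((F * G) i j) !fps_coefM !fps_coef_sum.
under eq_bigr do rewrite fps_coefM.
by rewrite exchange_big; apply: eq_bigr => k _; rewrite fps_coefM.
Qed.

HB.instance Definition _ := GRing.isZmodMorphism.Build
  (fps (fps R)) (fps (fps R)) (@fps_swap R) fps_swap_is_zmod_morphism.
HB.instance Definition _ := GRing.isMonoidMorphism.Build
  (fps (fps R)) (fps (fps R)) (@fps_swap R) fps_swap_is_monoid_morphism.

Lemma fps_swapCC c : fps_swap (fpsC (fpsC c)) = fpsC (fpsC c).
Proof. by apply/fpsP => -[|j]; apply/fpsP => -[|i]. Qed.

Lemma fps_swap_lam : fps_swap lam = mu :> fps (fps R).
Proof.
by apply/fpsP => j; apply/fpsP => i /=; case: i j => [|i] [|[|j]].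
Qed.

Lemma fps_swap_mu : fps_swap mu = lam :> fps (fps R).
Proof. by rewrite -fps_swap_lam; apply/fpsP => j; apply/fpsP => i. Qed.

Lemma at_lam_add_muE F j i :
  at_lam_add_mu F j i = F (i + j)%N *+ 'C(i + j, i).
Proof. by []. Qed.

(** Symmetry of binomial coefficients; this is what later lets one cocycle identity serve both
    products. *)
Lemma fps_swap_at_lam_add_mu F :
  fps_swap (at_lam_add_mu F) = at_lam_add_mu F.
Proof.
apply/fpsP => j; apply/fpsP => i /=.
by rewrite addnC -(bin_sub (leq_addl i j)) addnK.
Qed.

Lemma at_lam_add_muD : {morph @at_lam_add_mu R : F G / F + G}.
Proof. by move=> F G; apply/fpsP => j; apply/fpsP => i /=; rewrite mulrnDl. Qed.

Lemma at_lam_add_muCM c F :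
  at_lam_add_mu (fpsC c * F) = fpsC (fpsC c) * at_lam_add_mu F.
Proof.
apply/fpsP => j; apply/fpsP => i.
by rewrite !fps_coefCM !at_lam_add_muE fps_coefCM mulrnAr.
Qed.

(** Pascal's rule in generating-function form. With [at_lam_add_muD] and [at_lam_add_muCM] it
    carries any factor linear in the series variable through the substitution. *)
Lemma at_lam_add_muXM F :
  at_lam_add_mu (fpsX * F) = (lam + mu) * at_lam_add_mu F.
Proof.
rewrite mulrDl; apply/fpsP => j; apply/fpsP => i.
(* [lam] is constant in the outer variable, so it acts on each outer coefficient as multiplication
   by [fpsX]. *)
have -> : (lam * at_lam_add_mu F + mu * at_lam_add_mu F) j i =
  (fpsX * at_lam_add_mu F j) i + (mu * at_lam_add_mu F) j i.
  by rewrite -fps_coefCM.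
rewrite at_lam_add_muE; case: i j => [|i] [|j].
- by rewrite !fps_coefX0M mul0rn addr0.
- by rewrite fps_coefX0M !fps_coefXSM at_lam_add_muE !bin0 add0r.
- by rewrite fps_coefX0M !addn0 !fps_coefXSM at_lam_add_muE addn0 !binn addr0.
rewrite addSn !fps_coefXSM !at_lam_add_muE binS addSnnS mulrnDr.
exact: addrC.
Qed.

End BivariateFps.

HB.instance Definition _ (R : comNzRingType) :=
  GRing.RMorphism.copy (@at_lam R) (@fpsC (fps R)).
HB.instance Definition _ (R : comNzRingType) :=
  GRing.RMorphism.copy (@at_mu R) (@fps_swap R \o @at_lam R).

(** * The shift of the derivation variable and its Taylor coefficients *)

Section PolyShift.
Variable K : comNzRingType.
Implicit Types (p : {poly K}) (F : fps {poly K}).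

Lemma poly_shiftE p :
  poly_shift p =
    (map_poly (@fpsC {poly K} \o @polyC K) p).[fpsC 'X + fpsX].
Proof. by []. Qed.

Fact poly_shift_is_zmod_morphism : zmod_morphism (@poly_shift K).
Proof. by move=> p q; rewrite !poly_shiftE rmorphB hornerD hornerN. Qed.

Fact poly_shift_is_monoid_morphism : monoid_morphism (@poly_shift K).
Proof.
by split=> [|p q]; rewrite !poly_shiftE ?rmorph1 ?hornerC // rmorphM hornerM.
Qed.

HB.instance Definition _ := GRing.isZmodMorphism.Build
  {poly K} (fps {poly K}) (@poly_shift K) poly_shift_is_zmod_morphism.
HB.instance Definition _ := GRing.isMonoidMorphism.Build
  {poly K} (fps {poly K}) (@poly_shift K) poly_shift_is_monoid_morphism.

Lemma poly_shiftX : poly_shift 'X = fpsC 'X + fpsX :> fps {poly K}.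
Proof. by rewrite poly_shiftE map_polyX hornerX. Qed.

Lemma poly_shiftC (c : K) : poly_shift c%:P = fpsC c%:P.
Proof. by rewrite poly_shiftE map_polyC hornerC. Qed.

(** Taylor's formula at ['X] with increment [fpsX]; the normalized derivatives already contain the
    division by [k!]. *)
Lemma coef_poly_shift p k : poly_shift p k = p^`N(k).
Proof.
set f := @fpsC {poly K} \o @polyC K.
have coef_term i :
    ((map_poly f p)^`N(i).[fpsC 'X] * fpsX ^+ i) k = p^`N(i) *+ (k == i).
  rewrite nderivn_map map_poly_comp horner_map.
  by rewrite fps_coefCM fps_coefXn mulr_natr -/(comp_poly _ _) comp_polyXr.
(* The Taylor sum is lengthened so that index [k] occurs in it even when [k] is beyond the degree of
   [p]. *)
have le_pn : (size (map_poly f p) <= maxn k.+1 (size p))%N.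
  by rewrite (leq_trans (size_poly _ _)) // leq_maxr.
have lt_kn : (k < maxn k.+1 (size p))%N by rewrite leq_max ltnSn.
rewrite poly_shiftE (nderiv_taylor_wide (mulrC _ _) le_pn) fps_coef_sum.
under eq_bigr do rewrite coef_term.
rewrite (bigD1 (Ordinal lt_kn)) //= eqxx big1 ?addr0 // => i neq_ik.
by rewrite eq_sym -[k]/(val (Ordinal lt_kn)) (inj_eq val_inj) (negPf neq_ik).
Qed.

Fact at_shift_lam_mu_is_zmod_morphism : zmod_morphism (@at_shift_lam_mu K).
Proof. by move=> F G; apply/fpsP => j; rewrite [LHS]/= rmorphB. Qed.

Fact at_shift_lam_mu_is_monoid_morphism : monoid_morphism (@at_shift_lam_mu K).
Proof.
split=> [|F G]; apply/fpsP => j; first by rewrite [LHS]/= rmorph_nat.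
by rewrite [LHS]/= rmorph_sum; apply: eq_bigr => i _; rewrite rmorphM.
Qed.

HB.instance Definition _ := GRing.isZmodMorphism.Build
  (fps {poly K}) (fps (fps {poly K})) (@at_shift_lam_mu K)
  at_shift_lam_mu_is_zmod_morphism.
HB.instance Definition _ := GRing.isMonoidMorphism.Build
  (fps {poly K}) (fps (fps {poly K})) (@at_shift_lam_mu K)
  at_shift_lam_mu_is_monoid_morphism.

Lemma at_shift_lam_muC p : at_shift_lam_mu (fpsC p) = fpsC (poly_shift p).
Proof. by apply/fpsP => j; rewrite [LHS]/= rmorphMn. Qed.

Lemma at_shift_lam_muX : at_shift_lam_mu fpsX = mu :> fps (fps {poly K}).
Proof. by apply/fpsP => j; rewrite [LHS]/= rmorph_nat. Qed.

End PolyShift.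

HB.instance Definition _ (K : comNzRingType) :=
  GRing.RMorphism.copy (@at_shift_mu_lam K)
    (@fps_swap {poly K} \o @at_shift_lam_mu K).

(** * Leibniz rule for [frakL] and the cocycle identity *)

Section Cocycle.
Variables (K : numFieldType) (n : nat) (C : 'M[{poly K}]_n).
Implicit Types X Y : 'M[{poly K}]_n.

Let D : 'M[{poly K}]_n -> 'M[{poly K}]_n := map_mx (@deriv K).

Fact frakL_is_zmod_morphism : zmod_morphism (frakL C).
Proof.
by move=> X Y; rewrite /frakL map_mxB mulmxBr opprD addrACA.
Qed.

HB.instance Definition _ := GRing.isZmodMorphism.Build
  'M[{poly K}]_n 'M[{poly K}]_n (frakL C) frakL_is_zmod_morphism.

(** [C] multiplies on the left, so it is absorbed by the factor [X], and [Y] sees only the plain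
    derivative. *)
Lemma frakLM X Y : frakL C (X *m Y) = frakL C X *m Y + X *m D Y.
Proof.
rewrite /frakL mulmxDl mulmxA [RHS]addrAC; congr (_ + _).
apply/matrixP => i j; rewrite !mxE raddf_sum -big_split.
by apply: eq_bigr => k _; rewrite /= derivM !mxE.
Qed.

Lemma iter_frakLM k X Y :
  iter k (frakL C) (X *m Y) =
    \sum_(p < k.+1) iter p (frakL C) X *m iter (k - p) D Y *+ 'C(k, p).
Proof.
elim: k => [|k IHk]; first by rewrite big_ord1.
rewrite iterS IHk raddf_sum.
under eq_bigr do rewrite raddfMn /= frakLM mulrnDl.
rewrite big_split [RHS]big_ord_recl /=.
under [in RHS]eq_bigr do rewrite /bump leq0n add1n binS mulrnDr subSS.
(* The terms where [frakL] hits [X] match the ['C(k, p)] half of Pascal's rule; the others remain to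
   be matched with the ['C(k, p.+1)] half and the term of index 0. *)
rewrite big_split /= [LHS]addrC addrA; congr (_ + _).
rewrite [LHS]big_ord_recl [in RHS]big_ord_recr /=.
(* The extra last term on the right has coefficient ['C(k, k.+1) = 0]. *)
rewrite (bin_small (ltnSn k)) mulr0n addr0 !bin0 !subn0; congr (_ + _).
apply: eq_bigr => p _; rewrite /bump leq0n add1n -(iterS (k - p.+1) D Y).
by rewrite -subSn ?subSS.
Qed.

Lemma iter_mx_deriv q Y i j : iter q D Y i j = (Y i j)^`N(q) *+ q`!.
Proof.
rewrite -nderivn_def; elim: q => // q IHq.
by rewrite iterS derivnS -IHq mxE.
Qed.

Lemma expLE i j k :
  expL C i j k = k`!%:R^-1 *: (iter k (frakL C) 1%:M) i j.
Proof. by rewrite mxE. Qed.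

(** The numerical content of the cocycle identity: on the right, [(i - p)!] comes from the
    normalized derivative, ['C(i, p)] from the Leibniz rule and ['C(i + j, i)] from expanding a
    power of the sum of the variables. Characteristic 0 makes the factorials invertible. *)
Lemma invf_fact_binomials (p i j : nat) : (p <= i)%N ->
  p`!%:R^-1 * j`!%:R^-1 =
    (i + j)`!%:R^-1 * ((i - p)`! * 'C(i, p) * 'C(i + j, i))%:R :> K.
Proof.
move=> le_pi; have fact_neq0 k : k`!%:R != 0 :> K.
  by rewrite Num.Theory.pnatr_eq0 -lt0n fact_gt0.
apply: (mulfI (fact_neq0 (i + j)%N)); rewrite mulVKf //.
apply: (mulIf (fact_neq0 p)); apply: (mulIf (fact_neq0 j)).
transitivity ((i + j)`!%:R : K); first by field; rewrite !fact_neq0.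
rewrite -!natrM -(bin_fact (leq_addr j i)) addKn -(bin_fact le_pi).
by congr (_%:R); ring.
Qed.

Lemma expL_cocycle :
  map_mx at_lam (expL C) *m map_mx at_shift_lam_mu (expL C) =
    map_mx at_lam_add_mu (expL C).
Proof.
apply/matrixP => r s; apply/fpsP => j; apply/fpsP => i.
rewrite [RHS](_ : _ = at_lam_add_mu (expL C r s) j i); last by rewrite mxE.
(* Writing [L^(i+j) I] as [L^i (I * L^j I)] exposes a product to which the iterated Leibniz rule
   applies. *)
rewrite at_lam_add_muE expLE iterD -[iter j _ _]mul1mx iter_frakLM.
rewrite mxE !fps_coef_sum summxE scaler_sumr -sumrMnl.
have termE t : (map_mx at_lam (expL C) r t *
    map_mx at_shift_lam_mu (expL C) t s) j i =
  \sum_(p < i.+1) (p`!%:R^-1 * j`!%:R^-1) *: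
    ((iter p (frakL C) 1%:M) r t *
     ((iter j (frakL C) 1%:M) t s)^`N(i - p)).
  rewrite [map_mx at_lam _ _ _]mxE [map_mx at_shift_lam_mu _ _ _]mxE.
  (* The left factor is constant in [mu], so [mu^j] comes from the shifted factor alone, and only
     [lambda^i] needs a convolution. *)
  rewrite /at_lam fps_coefCM fps_coefM; apply: eq_bigr => p _.
  rewrite coef_poly_shift !expLE nderivnZ.
  by rewrite -scalerAl -scalerAr scalerA.
under eq_bigr do rewrite termE.
rewrite exchange_big; apply: eq_bigr => p _.
have le_pi : (p <= i)%N by rewrite -ltnS.
rewrite -scaler_sumr (invf_fact_binomials _ _ _ le_pi).
rewrite -scalerA scaler_nat mulmxnE mxE !mulrnA !scalerMnr.
congr (_ *: (_ *+ _ *+ _)).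
rewrite -sumrMnl; apply: eq_bigr => t _.
by rewrite iter_mx_deriv mulrnAr.
Qed.

End Cocycle.

(** * The linear scalar factor under the unshifted substitutions *)

Section LinearFactor.
Variables (R : comNzRingType) (x a b : R).
Let g : fps R := fpsC x + fpsC a * fpsX + fpsC b.
Let cst (c : R) : fps (fps R) := fpsC (fpsC c).

Lemma at_lam_factor : at_lam g = cst x + cst a * lam + cst b.
Proof. by rewrite 2!rmorphD rmorphM. Qed.

Lemma at_mu_factor : at_mu g = cst x + cst a * mu + cst b.
Proof.
rewrite -[at_mu g]/(fps_swap (at_lam g)) at_lam_factor.
by rewrite 2!rmorphD rmorphM /= !fps_swapCC fps_swap_lam.
Qed.

Lemma fps_swap_shift_factor :
  fps_swap (cst x + lam + cst a * mu + cst b) =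
    cst x + mu + cst a * lam + cst b.
Proof.
by rewrite 3!rmorphD rmorphM /= !fps_swapCC fps_swap_lam fps_swap_mu.
Qed.

Lemma at_lam_add_mu_factorM (F : fps R) :
  at_lam_add_mu (g * F) =
    (cst x + cst a * (lam + mu) + cst b) * at_lam_add_mu F.
Proof.
rewrite !mulrDl -(mulrA (fpsC a)) !at_lam_add_muD !at_lam_add_muCM.
by rewrite at_lam_add_muXM mulrA.
Qed.

Lemma at_lam_add_mu_factorZ m n (E : 'M[fps R]_(m, n)) :
  map_mx at_lam_add_mu (g *: E) =
    (cst x + cst a * (lam + mu) + cst b) *: map_mx at_lam_add_mu E.
Proof. by apply/matrixP => i j; rewrite !mxE at_lam_add_mu_factorM. Qed.

Lemma at_lam_factorZ m n (E : 'M[fps R]_(m, n)) :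
  map_mx at_lam (g *: E) =
    (cst x + cst a * lam + cst b) *: map_mx at_lam E.
Proof. by rewrite -at_lam_factor map_mxZ. Qed.

Lemma at_mu_factorZ m n (E : 'M[fps R]_(m, n)) :
  map_mx at_mu (g *: E) =
    (cst x + cst a * mu + cst b) *: map_mx at_mu E.
Proof. by rewrite -at_mu_factor map_mxZ. Qed.

End LinearFactor.

(** * The linear scalar factor under the shifted substitutions *)

Section ShiftFactor.
Variables (K : comNzRingType) (a b : K).
Let g : fps {poly K} := fpsC 'X + fpsC a%:P * fpsX + fpsC b%:P.
Let cst (p : {poly K}) : fps (fps {poly K}) := fpsC (fpsC p).

Lemma at_shift_lam_mu_factor :
  at_shift_lam_mu g = cst 'X + lam + cst a%:P * mu + cst b%:P.
Proof.
rewrite 2!rmorphD rmorphM /= !at_shift_lam_muC at_shift_lam_muX.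
by rewrite !poly_shiftC poly_shiftX rmorphD.
Qed.

Lemma at_shift_mu_lam_factor :
  at_shift_mu_lam g = cst 'X + mu + cst a%:P * lam + cst b%:P.
Proof.
rewrite -[at_shift_mu_lam g]/(fps_swap (at_shift_lam_mu g)).
by rewrite at_shift_lam_mu_factor fps_swap_shift_factor.
Qed.

Lemma at_shift_lam_mu_factorZ m n (E : 'M[fps {poly K}]_(m, n)) :
  map_mx at_shift_lam_mu (g *: E) =
    (cst 'X + lam + cst a%:P * mu + cst b%:P) *: map_mx at_shift_lam_mu E.
Proof. by rewrite -at_shift_lam_mu_factor map_mxZ. Qed.

Lemma at_shift_mu_lam_factorZ m n (E : 'M[fps {poly K}]_(m, n)) :
  map_mx at_shift_mu_lam (g *: E) =
    (cst 'X + mu + cst a%:P * lam + cst b%:P) *: map_mx at_shift_mu_lam E.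
Proof. by rewrite -at_shift_mu_lam_factor map_mxZ. Qed.

End ShiftFactor.

(** * The scalar identity and the final assembly *)

Lemma linear_factors_sub (S : comNzRingType) (n : nat) (x a b l m : S)
    (El Esl Em Esm H : 'M[S]_n) :
  El *m Esl = H -> Em *m Esm = H ->
  (l - m) *: ((x + a * (l + m) + b) *: H) =
    ((x + a * l + b) *: El) *m ((x + l + a * m + b) *: Esl)
    - ((x + a * m + b) *: Em) *m ((x + m + a * l + b) *: Esm).
Proof.
move=> defHl defHm.
rewrite -2!scalemxAl -2!scalemxAr defHl defHm !scalerA -scalerBl.
by congr (_ *: _); ring.
Qed.

(** Image of [expL_cocycle] under the ring morphism [fps_swap], which exchanges the roles of [lam]
    and [mu] on the left and fixes the right-hand side. *)
Lemma expL_cocycle_swap (K : numFieldType) (n : nat) (C : 'M[{poly K}]_n) :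
  map_mx at_mu (expL C) *m map_mx at_shift_mu_lam (expL C) =
    map_mx at_lam_add_mu (expL C).
Proof.
transitivity (map_mx (@fps_swap {poly K}) (map_mx at_lam_add_mu (expL C))).
  by rewrite -expL_cocycle map_mxM -!map_mx_comp.
by apply/matrixP => i j; rewrite !mxE fps_swap_at_lam_add_mu.
Qed.

Lemma solA_solution (K : numFieldType) (n : nat) (C : 'M[{poly K}]_n)
    (a b : K) :
  (lam - mu) *: map_mx at_lam_add_mu (solA C a b) =
    map_mx at_lam (solA C a b) *m map_mx at_shift_lam_mu (solA C a b)
    - map_mx at_mu (solA C a b) *m map_mx at_shift_mu_lam (solA C a b).
Proof.
rewrite /solA at_lam_add_mu_factorZ at_lam_factorZ at_mu_factorZ.
rewrite at_shift_lam_mu_factorZ at_shift_mu_lam_factorZ.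
exact: linear_factors_sub (expL_cocycle _ _ C) (expL_cocycle_swap _ _ C).
Qed.

Theorem proposition4p4 (R : realType) (n : nat) (hn : (0 < n)%N)
    (C : 'M[{poly R[i]}]_n) (a b : R[i]) :
  let A : 'M[fps {poly R[i]}]_n := solA C a b in
  (lam - mu) *: map_mx at_lam_add_mu A =
    map_mx at_lam A *m map_mx at_shift_lam_mu A
    - map_mx at_mu A *m map_mx at_shift_mu_lam A.
Proof. exact: solA_solution. Qed.
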